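(* Chromatic symmetric functions satisfy the modular law: for every modular triple $(h_-,h,h_+)$ of Hessenberg functions in $\mathcal{H}(n)$, $$(1+q)\,\mathrm{csf}_{h}(q)=\mathrm{csf}_{h_+}(q)+q\,\mathrm{csf}_{h_-}(q).$$
   Context: Let $[n]=\{1,\dots,n\}$ and let $\mathbb{P}$ be the set of positive integers. A Hessenberg function is a non-decreasing map $h\colon[n]\to[n]$ with $h(j)\ge j$ for all $j$; $\mathcal{H}(n)$ is the set of them. Modular triples: $(h_-,h,h_+)$ in $\mathcal{H}(n)$ is a modular triple if one of the following holds. (C) $h(d)=h(d+1)$ and $h^{-1}(d)=\{d_0\}$ for some $1\le d_0<d<n$, and $h_-(d_0)=d-1$, $h_+(d_0)=d+1$, $h_\pm(j)=h(j)$ for $j\ne d_0$. (R) $h(d')+1=h(d'+1)\ne d'+1$ and $h^{-1}(d')=\emptyset$ for some $1\le d'<n$, and $h_-(d'+1)=h(d')$, $h_-(j)=h(j)$ for $j\ne d'+1$, $h_+(d')=h(d')+1$, $h_+(j)=h(j)$ for $j\ne d'$. The indifference graph $G_h$ has vertex set $[n]$ and edge set $E(G_h)=\{\{i,j\}\mid j<i\le h(j)\}$. A map $\kappa\colon[n]\to\mathbb{P}$ is a proper coloring of $G_h$ if $\kappa(i)\ne\kappa(j)$ whenever $\{i,j\}\in E(G_h)$; $PC(G_h)$ is the set of proper colorings. For variables $z_1,z_2,\dots$ put $\mathbf{z}_\kappa=z_{\kappa(1)}\cdots z_{\kappa(n)}$, and $\mathrm{asc}(\kappa)=\#\{\{i,j\}\in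 E(G_h)\mid j<i,\ \kappa(j)<\kappa(i)\}$ (computed with respect to $G_h$). The (graded) chromatic symmetric function is $$\mathrm{csf}_h(q)=\sum_{\kappa\in PC(G_h)}\mathbf{z}_\kappa\,q^{\mathrm{asc}(\kappa)},$$ a polynomial in $q$ whose coefficients are symmetric functions in $z_1,z_2,\dots$. *)

(* Defs.v *)
From HB Require Import structures.
From mathcomp Require Import all_boot all_order all_algebra.
From mathcomp Require Import finmap monalg.
From mathcomp Require Import boolp classical_sets functions cardinality fsbigop.

Set Implicit Arguments.
Unset Strict Implicit.
Unset Printing Implicit Defensive.

Import GRing.Theory.
Local Open Scope ring_scope.

(* The interval [n] = {1, ..., n} is encoded as 'I_n = {0, ..., n-1}, with      *)
(* i : 'I_n standing for i + 1. All the conditions below (comparisons, and      *)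
(* steps d -> d + 1 and d -> d - 1) are invariant under this shift.             *)

Definition hessenberg (n : nat) : {set {ffun 'I_n -> 'I_n}} :=
  [set h : {ffun 'I_n -> 'I_n} |
    [forall j : 'I_n, j <= h j]%N &&
    [forall j : 'I_n, forall k : 'I_n, (j <= k)%N ==> (h j <= h k)%N]]%SET.

(* d1 is d + 1; its existence in 'I_n is the requirement d < n.                 *)
Definition modular_C (n : nat) (hm h hp : {ffun 'I_n -> 'I_n}) : Prop :=
  exists d0 d d1 : 'I_n,
    [/\ (d0 < d)%N /\ d1 = d.+1 :> nat,
        h d = h d1 /\ (h @^-1: [set d] = [set d0])%SET,
        hm d0 = d.-1 :> nat /\ hp d0 = d.+1 :> nat &
        forall j : 'I_n, j <> d0 -> hm j = h j /\ hp j = h j].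

Definition modular_R (n : nat) (hm h hp : {ffun 'I_n -> 'I_n}) : Prop :=
  exists d d1 : 'I_n,
    [/\ d1 = d.+1 :> nat,
        (h d).+1 = h d1 :> nat /\ h d1 <> d1,
        (h @^-1: [set d] = finset.set0)%SET,
        hm d1 = h d /\ (forall j : 'I_n, j <> d1 -> hm j = h j) &
        hp d = (h d).+1 :> nat /\ (forall j : 'I_n, j <> d -> hp j = h j)].

Definition modular_triple (n : nat) (hm h hp : {ffun 'I_n -> 'I_n}) : Prop :=
  [/\ hm \in hessenberg n, h \in hessenberg n, hp \in hessenberg n &
      modular_C hm h hp \/ modular_R hm h hp].

Definition indifference (n : nat) (h : {ffun 'I_n -> 'I_n}) : rel 'I_n :=
  fun i j => (j < i <= h j)%N || (i < j <= h i)%N.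

Definition posint : Type := {k : nat | (0 < k)%N}.
HB.instance Definition _ := Countable.on posint.

Notation coloring n := {ffun 'I_n -> posint}.

Definition proper_colorings (n : nat) (h : {ffun 'I_n -> 'I_n}) :
    set (coloring n) :=
  [set k : coloring n |
    forall i j : 'I_n, indifference h i j -> k i <> k j]%classic.

(* Each edge {i, j} is counted once, through its orientation with j < i.        *)
Definition asc (n : nat) (h : {ffun 'I_n -> 'I_n}) (k : coloring n) : nat :=
  #|[set e : 'I_n * 'I_n | [&& indifference h e.1 e.2, (e.2 < e.1)%N
                             & (val (k e.2) < val (k e.1))%N]]%SET|.

(* Formal power series in z_1, z_2, ... with coefficients in int[q], given by   *)
(* their coefficient functions; {cmonom posint} is the type of monomials in the *)
(* z_a and 'X : {poly int} is q. The regular module {poly int}^o makes scaling  *)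
(* *: on qseries the multiplication by a polynomial in q.                       *)
Definition qseries : Type := {cmonom posint} -> {poly int}^o.
HB.instance Definition _ := GRing.Lmodule.on qseries.

Definition zmonomial (n : nat) (k : coloring n) : {cmonom posint} :=
  \big[mmul/mone]_(i < n) ucm (k i).

Lemma finite_coloring_monomial (n : nat) (m : {cmonom posint}) :
  finite_set [set k : coloring n | zmonomial k = m]%classic.
Proof.
pose F (g : {ffun 'I_n -> finsupp m}) : coloring n := [ffun i => val (g i)].
have : finite_set (range F) by apply/finite_image/finite_finset.
apply: sub_finite_set => k /= km.
have supp i : k i \in finsupp m.
  by rewrite -km /zmonomial (bigD1 i) //= mdomD mdomU !inE eqxx.
exists [ffun i => [` supp i]%fset] => //.
by apply/ffunP => i; rewrite !ffunE.
Qed.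

(* The coefficient at a monomial m collects the proper colorings k with         *)
(* z_k = m; they are finitely many by finite_coloring_monomial, so that the     *)
(* finitely supported sum is the actual sum.                                    *)
Definition csf (n : nat) (h : {ffun 'I_n -> 'I_n}) : qseries := fun m =>
  \sum_(k \in (proper_colorings h `&` [set k | zmonomial k = m])%classic)
    ('X^(asc h k) : {poly int}).

(* Main.v *)
Require Import Defs.
From mathcomp Require Import all_boot all_order all_algebra.
From mathcomp Require Import perm finmap monalg.
From mathcomp Require Import boolp classical_sets functions cardinality fsbigop.
From mathcomp Require Import ring zify.

Import GRing.Theory.
Local Open Scope ring_scope.

(** Give every coloring [k], proper or not, a weight in Z[q]: the product, over
the edges [j < i] of the graph, of a local factor that is 0 if [k j = k i], and
otherwise q or 1 according to whether [k j < k i]. It equals q^asc on proper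
colorings and vanishes on the others, so each coefficient of the chromatic
symmetric function is a sum of weights over all colorings with a given monomial
([csf_weight]), a domain that does not depend on the Hessenberg function.

In a modular triple of either kind the three graphs differ by two edges only:
passing from h_- to h, and then from h to h_+, adds one edge each time, and
these two edges join one vertex c (c = d_0 in case (C), c = h(d + 1) in case
(R)) to each of the two consecutive vertices d and d + 1 ([weight_raise]).
Moreover, in the graph of h_-, d and d + 1 are adjacent and have the same other
neighbors, each of them on the same side of both. Therefore exchanging the colors
of d and d + 1 affects the weight for h_- only through the edge {d, d + 1}
([weight_twins]).

Let D(k) be (1 + q) w_h(k) - w_{h_+}(k) - q w_{h_-}(k). The preceding remarks
reduce D(k) + D(k') = 0, where k' is k with the colors of d and d + 1 exchanged,
to an identity in three colors, which is checked on each relative order of them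
([pair_weight_left], [pair_weight_right]). The exchange is an involution that
preserves monomials, so the sum of D over the colorings with a given monomial is
its own opposite, hence 0; this is the modular law. *)

(** The factor of an edge whose smaller endpoint has color [a] and whose larger
endpoint has color [b]. *)
Definition pair_weight (a b : posint) : {poly int} :=
  if a == b then 0 else 'X^(val a < val b)%N.

(** Edges are listed with the smaller endpoint first, the opposite of the
convention for pairs in [asc]. *)
Definition edges {n : nat} (h : {ffun 'I_n -> 'I_n}) : {set 'I_n * 'I_n} :=
  [set e : 'I_n * 'I_n | (e.1 < e.2 <= h e.1)%N]%SET.

Definition weight {n : nat} (h : {ffun 'I_n -> 'I_n}) (k : coloring n) :
    {poly int} :=
  \prod_(e in edges h) pair_weight (k e.1) (k e.2).

Definition swap_colors {n : nat} (d d1 : 'I_n) (k : coloring n) : coloring n :=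
  [ffun i => k (tperm d d1 i)].

Lemma swap_colorsK {n : nat} (d d1 : 'I_n) :
  involutive (swap_colors d d1).
Proof. by move=> k; apply/ffunP => i; rewrite !ffunE tpermK. Qed.

Lemma zmonomial_swap {n : nat} (d d1 : 'I_n) (k : coloring n) :
  zmonomial (swap_colors d d1 k) = zmonomial k.
Proof.
rewrite /zmonomial [RHS](reindex_inj (@perm_inj _ (tperm d d1))) /=.
by apply: eq_bigr => i _; rewrite ffunE.
Qed.

Lemma weight_proper {n : nat} (h : {ffun 'I_n -> 'I_n}) (k : coloring n) :
  proper_colorings h k -> weight h k = 'X^(asc h k).
Proof.
move=> kP; rewrite /weight /asc -sum1_card.
have -> : \prod_(e in edges h) pair_weight (k e.1) (k e.2) =
    \prod_(e in edges h) ('X ^+ (val (k e.1) < val (k e.2))%N : {poly int}).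
  apply: eq_bigr => e; rewrite inE => he; rewrite /pair_weight ifN //.
  by apply/eqP/kP; rewrite /indifference he orbT.
(* What remains is a bijection between edges and pairs counted by [asc], which
   exchanges the two components. *)
rewrite prodrXr; congr (_ ^+ _).
pose f (e : 'I_n * 'I_n) := (e.2, e.1).
have fK : involutive f by case.
rewrite [RHS](reindex_inj (inv_inj fK)) big_mkcond [RHS]big_mkcond /=.
apply: eq_bigr => -[j i] _; rewrite !inE /f /indifference /=.
case: (ltngtP j i) => /= _; rewrite ?andbF //.
by case: (i <= h j)%N => //=; case: (_ < _)%N.
Qed.

Lemma weight_improper {n : nat} (h : {ffun 'I_n -> 'I_n}) (k : coloring n) :
  ~ proper_colorings h k -> weight h k = 0.
Proof.
move/existsNP => [i /existsNP [j /not_implyP [hij /contrapT kij]]].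
wlog ji : i j hij kij / (j < i)%N.
  move=> H; case: (ltnP j i) => [|ij]; first exact: H.
  apply: (H j i) => //; first by move: hij; rewrite /indifference orbC.
  by move: hij; rewrite /indifference; lia.
rewrite /weight (bigD1 (j, i)) /=; last first.
  by rewrite inE /=; move: hij; rewrite /indifference; lia.
by rewrite /pair_weight kij eqxx mul0r.
Qed.

(** As improper colorings have weight 0, properness disappears from the index
set, and the sums for different Hessenberg functions become comparable term by
term. *)
Lemma csf_weight {n : nat} (h : {ffun 'I_n -> 'I_n}) (m : {cmonom posint}) :
  csf h m = \sum_(k \in [set k | zmonomial k = m]%classic) weight h k.
Proof.
rewrite /csf setIC fsbig_mkcondr; apply: eq_fsbigr => k _.
case: ifPn => [/set_mem|/negP nk]; first by move/weight_proper.
by rewrite weight_improper // => /mem_set.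
Qed.

(** The sum is equal to its opposite after reindexing by the involution, and
Z[q] has no 2-torsion. *)
Lemma fsbig_antisymmetric {T : choiceType} (A : set T) (s : T -> T)
    (F : T -> {poly int}) :
  finite_set A -> involutive s -> (forall x, A x -> A (s x)) ->
  (forall x, F x + F (s x) = 0) -> \sum_(x \in A) F x = 0.
Proof.
move=> finA sK sA sF.
have sB : set_bij A A s.
  split=> [x /sA //| |x Ax]; first by move=> x y _ _; exact: inv_inj.
  by exists (s x); [exact: sA|exact: sK].
have E : \sum_(x \in A) F x + \sum_(x \in A) F x = 0.
  rewrite {2}(reindex_fsbig s A A) // -fsbig_split //=.
  exact: fsbig1.
apply/eqP; move/eqP: E.
by rewrite -mulr2n -mulr_natl -polyC_natr mulf_eq0 polyC_eq0.
Qed.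

Lemma modular_law_swap {n : nat} (hm h hp : {ffun 'I_n -> 'I_n}) (d d1 : 'I_n) :
  let D k := (1 + 'X) * weight h k - weight hp k - 'X * weight hm k in
  (forall k, D k + D (swap_colors d d1 k) = 0) ->
  (1 + 'X : {poly int}) *: csf h = csf hp + ('X : {poly int}) *: csf hm.
Proof.
move=> D DP; apply/funext => m.
rewrite -[LHS]/((1 + 'X) * csf h m) -[RHS]/(csf hp m + 'X * csf hm m).
have finA := @finite_coloring_monomial n m.
apply/eqP; rewrite -subr_eq0 opprD addrA; apply/eqP.
rewrite -[RHS](@fsbig_antisymmetric _ [set k | zmonomial k = m]%classic
  (swap_colors d d1) D) //.
- rewrite !csf_weight !fsbig_finite //= !mulr_sumr -!sumrB.
  by [].
- exact: swap_colorsK.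
- by move=> k; rewrite /= zmonomial_swap.
Qed.

(** The hypotheses say that [d] and [d1] are adjacent twins: they have the same
larger neighbors because [h d = h d1], and the same smaller ones because no
smaller vertex has its last neighbor at [d]. The transposition of [d] and [d1]
therefore permutes the edges other than [(d, d1)], keeping their orientation;
[T] is the product over these. *)
Lemma weight_twins {n : nat} (h : {ffun 'I_n -> 'I_n}) (d d1 : 'I_n) :
  d1 = d.+1 :> nat -> h d = h d1 -> (d1 <= h d)%N ->
  (forall j : 'I_n, (j < d)%N -> h j <> d) ->
  exists2 T : coloring n -> {poly int},
    forall k, weight h k = pair_weight (k d) (k d1) * T k &
    forall k, T (swap_colors d d1 k) = T k.
Proof.
move=> d1E hd dd1 hj.
exists (fun k => \prod_(e in edges h :\ (d, d1)) pair_weight (k e.1) (k e.2)).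
  move=> k; rewrite /weight (big_setD1 (d, d1)) //= inE /=; lia.
move=> k.
pose f (e : 'I_n * 'I_n) := (tperm d d1 e.1, tperm d d1 e.2).
have fK : involutive f by case=> j i; rewrite /f /= !tpermK.
rewrite [RHS](reindex_inj (inv_inj fK)).
apply: eq_big => [[j i]|[j i] _]; last by rewrite /= !ffunE.
rewrite !inE /f !xpair_eqE /=.
have hj' : (j < d)%N -> h j <> d :> nat by move=> /hj H /val_inj.
have hdn : h d = h d1 :> nat by rewrite hd.
case: tpermP => [->|->|/eqP + /eqP +];
  case: tpermP => [->|->|/eqP + /eqP +]; rewrite -!val_eqE /=; lia.
Qed.

(** Raising one value [h j] by one adds the single edge from [j] to the vertex
just after [h j]. *)
Lemma weight_raise {n : nat} (h h' : {ffun 'I_n -> 'I_n}) (j i : 'I_n) :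
  (j <= h j)%N -> i = (h j).+1 :> nat -> h' j = i ->
  (forall l, l <> j -> h' l = h l) ->
  forall k, weight h' k = pair_weight (k j) (k i) * weight h k.
Proof.
move=> jh iE h'j h'P k.
have -> : weight h' k =
    \prod_(e in (j, i) |: edges h) pair_weight (k e.1) (k e.2).
  apply: eq_bigl => -[u v]; rewrite !inE xpair_eqE /=.
  have [->|/eqP uj] := eqVneq u j; last by rewrite h'P.
  by rewrite h'j -val_eqE /=; lia.
by rewrite big_setU1 // inE /=; lia.
Qed.

(** The three-color identity when the common vertex, of color [c], precedes the
two twins, whose colors are [a] and [b]. In [L x y], [x] is the color of the
twin joined to it by [h] and [y] that of the twin joined to it by [h_+] only.
For instance, if [c < a < b], then [L a b] is [(1 + q) q - q^2 - q = 0], and so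
is [L b a]; if [c = a < b], then [L a b = - q] and [L b a = q^2], and the
factors [q] and [1] of the edge between the twins make the two terms cancel. *)
Lemma pair_weight_left (a b c : posint) :
  let L x y := (1 + 'X) * pair_weight c x
               - pair_weight c x * pair_weight c y - 'X in
  pair_weight a b * L a b + pair_weight b a * L b a = 0.
Proof.
rewrite /pair_weight -!val_eqE /=; 
case: (ltngtP (val a) (val b)) => ?; case: (ltngtP (val c) (val a)) => ?;
  case: (ltngtP (val c) (val b)) => ?; try lia; rewrite /=; ring.
Qed.

(** The mirror identity, when the common vertex follows the two twins. The twin
joined to it by [h] is now the larger one, of color [y]. *)
Lemma pair_weight_right (a b c : posint) :
  let L x y := (1 + 'X) * pair_weight y c
               - pair_weight x c * pair_weight y c - 'X in
  pair_weight a b * L a b + pair_weight b a * L b a = 0.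
Proof.
rewrite /pair_weight -!val_eqE /=.
case: (ltngtP (val a) (val b)) => ?; case: (ltngtP (val a) (val c)) => ?;
  case: (ltngtP (val b) (val c)) => ?; try lia; rewrite /=; ring.
Qed.

Lemma hessenberg_ge {n : nat} (h : {ffun 'I_n -> 'I_n}) :
  h \in hessenberg n -> forall j : 'I_n, (j <= h j)%N.
Proof. by rewrite inE => /andP [/forallP]. Qed.

Lemma modular_law_C {n : nat} (hm h hp : {ffun 'I_n -> 'I_n}) :
  hm \in hessenberg n -> h \in hessenberg n -> modular_C hm h hp ->
  (1 + 'X : {poly int}) *: csf h = csf hp + ('X : {poly int}) *: csf hm.
Proof.
move=> /hessenberg_ge geM /hessenberg_ge geH.
move=> [d0 [d [d1 [[d0d d1E] [hdd1 pre] [hmd0 hpd0] hE]]]].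
have hd0 : h d0 = d by apply/eqP; have := finset.set11 d0; rewrite -pre !inE.
have hj j : h j = d -> j = d0.
  by move=> hjd; apply/eqP; rewrite -finset.in_set1 -pre !inE hjd.
have d_d0 : d <> d0 by move=> E; rewrite E ltnn in d0d.
have d1_d0 : d1 <> d0 by move=> E; move: d0d; rewrite -E d1E; lia.
(* [d0] is the only vertex whose last neighbor for [h] is [d], and [hm] lowers
   its value to [d - 1]; this makes [d] and [d1] twins for [hm]. *)
have [T wT TS] : exists2 T : coloring n -> {poly int},
    forall k, weight hm k = pair_weight (k d) (k d1) * T k &
    forall k, T (swap_colors d d1 k) = T k.
  apply: weight_twins => // [||j jd].
  - by rewrite (hE d d_d0).1 (hE d1 d1_d0).1.
  - by rewrite (hE d d_d0).1 hdd1.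
  - case: (eqVneq j d0) => [->|/eqP jd0].
      by move/(congr1 val) => /=; lia.
    by rewrite (hE j jd0).1 => /hj.
have wH : forall k, weight h k = pair_weight (k d0) (k d) * weight hm k.
  apply: weight_raise => //; first by lia.
  by move=> l /hE [->].
have wP : forall k, weight hp k = pair_weight (k d0) (k d1) * weight h k.
  apply: weight_raise => //; first by rewrite hd0.
  - by apply: val_inj; rewrite /= hpd0 d1E.
  - by move=> l /hE [_ ->].
apply: (@modular_law_swap _ _ _ _ d d1) => k /=.
rewrite !wP !wH !wT TS !ffunE tpermL tpermR tpermD; [|exact/eqP|exact/eqP].
have /= := pair_weight_left (k d) (k d1) (k d0).
by move=> /(congr1 (fun x => x * T k)); rewrite mul0r => <-; ring.
Qed.

Lemma modular_law_R {n : nat} (hm h hp : {ffun 'I_n -> 'I_n}) :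
  hm \in hessenberg n -> h \in hessenberg n -> modular_R hm h hp ->
  (1 + 'X : {poly int}) *: csf h = csf hp + ('X : {poly int}) *: csf hm.
Proof.
move=> /hessenberg_ge geM /hessenberg_ge geH.
move=> [d [d1 [d1E [hdd1 hd1] pre [hmd1 hmE] [hpd hpE]]]].
have hj j : h j <> d.
  by move=> hjd; move/setP/(_ j): pre; rewrite !inE hjd eqxx.
have d_d1 : d <> d1 by move=> /(congr1 val) /=; lia.
(* [h d] is at least [d] but is not [d], which has no preimage; hence [d] and
   [d1] are adjacent. *)
have hd : (d < h d)%N.
  by rewrite ltn_neqAle geH andbT eq_sym; apply/eqP => /val_inj /hj.
have [T wT TS] : exists2 T : coloring n -> {poly int},
    forall k, weight hm k = pair_weight (k d) (k d1) * T k &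
    forall k, T (swap_colors d d1 k) = T k.
  apply: weight_twins => // [||j jd].
  - by rewrite hmd1 hmE.
  - by rewrite hmE // d1E.
  - by rewrite hmE // => /(congr1 val) /=; lia.
have wH : forall k, weight h k = pair_weight (k d1) (k (h d1)) * weight hm k.
  apply: weight_raise => //; first by rewrite hmd1.
  by move=> l /hmE ->.
have wP : forall k, weight hp k = pair_weight (k d) (k (h d1)) * weight h k.
  apply: weight_raise => //.
  by apply: val_inj; rewrite /= hpd hdd1.
apply: (@modular_law_swap _ _ _ _ d d1) => k /=.
have d_e : d <> h d1 by move=> /(congr1 val) /=; lia.
rewrite !wP !wH !wT TS !ffunE tpermL tpermR.
rewrite tpermD; [|exact/eqP|exact/eqP/nesym].
have /= := pair_weight_right (k d) (k d1) (k (h d1)).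
by move=> /(congr1 (fun x => x * T k)); rewrite mul0r => <-; ring.
Qed.

Theorem theoremC1 (n : nat) (hm h hp : {ffun 'I_n -> 'I_n})
    (Hmod : modular_triple hm h hp) :
  (1 + 'X : {poly int}) *: csf h = csf hp + ('X : {poly int}) *: csf hm.
Proof.
case: Hmod => hmH hH _ [triC|triR]; first exact: modular_law_C.
exact: modular_law_R.
Qed.
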